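(* Let $m,n\in\mathbb{N}$, let $\mu$ be a $(C,\gamma)$-absolutely decaying measure on $\mathbb{R}^n$ with $K=\operatorname{supp}\mu$, and let $0<\alpha<\frac{1}{2C^{1/\gamma}+1}$. Then for every uniformly discrete sequence $\mathcal Z=(Z_k)_{k\in\mathbb{N}}$ of subsets of $\mathbb{R}^m$ and every lacunary sequence $\mathcal M=(M_k)_{k\in\mathbb{N}}$ of real $m\times n$ matrices, the set $$\tilde E(\mathcal M,\mathcal Z)=\{\mathbf{x}\in\mathbb{R}^n:\ \inf_{k\in\mathbb{N}} d(M_k\mathbf{x},Z_k)>0\}$$ is $\alpha$-winning on $K$.
   Context: $d$ denotes Euclidean distance; $d(\mathbf{v},Z)=\inf_{\mathbf{z}\in Z}d(\mathbf{v},\mathbf{z})$. For a closed set $K\subset\mathbb{R}^n$ and $0<\alpha,\beta<1$, Schmidt's $(\alpha,\beta)$-game on $K$ with target set $S$ is played as follows: balls are $B(\mathbf{x},\rho)=\{\mathbf{x}'\in K: d(\mathbf{x},\mathbf{x}')\le\rho\}$ with $\mathbf{x}\in K$, $\rho>0$, and $(\mathbf{x}_2,\rho_2)\le_s(\mathbf{x}_1,\rho_1)$ means $\rho_2+d(\mathbf{x}_1,\mathbf{x}_2)\le\rho_1$. Bob picks $\omega_1=(\mathbf{x}_1,\rho_1)$ with $\mathbf{x}_1\in K$; then Alice and Bob alternately pick $\omega_k'=(\mathbf{x}_k',\rho_k')\le_s\omega_k$ and $\omega_{k+1}=(\mathbf{x}_{k+1},\rho_{k+1})\le_s\omega_k'$,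 all centers in $K$, with $\rho_k'=\alpha\rho_k$ and $\rho_{k+1}=\beta\rho_k'$. The nested balls intersect in a single point $\mathbf{x}_\infty$; Alice wins if $\mathbf{x}_\infty\in S$. A set $S\subset\mathbb{R}^n$ is $(\alpha,\beta)$-winning on $K$ if Alice has a strategy guaranteeing $\mathbf{x}_\infty\in S\cap K$ whatever Bob does, and $\alpha$-winning on $K$ if it is $(\alpha,\beta)$-winning on $K$ for every $\beta\in(0,1)$. A locally finite Borel measure $\mu$ on $\mathbb{R}^n$ is $(C,\gamma)$-absolutely decaying ($C,\gamma>0$) if there is $\rho_0>0$ such that $\mu(B(\mathbf{x},\rho)\cap\mathcal L^{(\varepsilon)})<C(\varepsilon/\rho)^\gamma\mu(B(\mathbf{x},\rho))$ for every affine hyperplane $\mathcal L\subset\mathbb{R}^n$, every $\mathbf{x}\in\operatorname{supp}\mu$, every $0<\rho<\rho_0$ and every $\varepsilon>0$; here $B(\mathbf{x},\rho)$ is the closed Euclidean ball and $\mathcal L^{(\varepsilon)}=\{\mathbf{x}:d(\mathbf{x},\mathcal L)\le\varepsilon\}$. A sequence $(M_k)$ of nonzero matrices is lacunary if $\inf_k \|M_{k+1}\|_{op}/\|M_k\|_{op}>1$. A set $Z\subset\mathbb{R}^m$ is $\delta$-uniformly discrete if $\inf_{\mathbf{x}\ne\mathbf{y}\in Z}d(\mathbf{x},\mathbf{y})>\delta$; a sequence $(Z_k)$ is uniformly discrete if for some $\delta>0$ every $Z_k$ is $\delta$-uniformly discrete. *)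

(* Defs.v *)
From Stdlib Require Import Reals.
From mathcomp Require Import ssreflect ssrfun ssrbool eqtype ssrnat seq fintype bigop.
Set Implicit Arguments.
Unset Strict Implicit.
Unset Printing Implicit Defensive.
Local Open Scope R_scope.

Definition vec (n : nat) := 'I_n -> R.
Definition mat (m n : nat) := 'I_m -> 'I_n -> R.

Definition rsum (n : nat) (f : 'I_n -> R) : R := \big[Rplus/R0]_(i < n) f i.

Definition dist (n : nat) (x y : vec n) : R :=
  sqrt (rsum (fun i => (x i - y i) ^ 2)).
Definition vnorm (n : nat) (x : vec n) : R := sqrt (rsum (fun i => (x i) ^ 2)).

Definition mat_app (m n : nat) (M : mat m n) (x : vec n) : vec m :=
  fun i => rsum (fun j => M i j * x j).

Definition is_opnorm (m n : nat) (M : mat m n) (r : R) : Prop :=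
  is_lub (fun t => exists x : vec n, vnorm x <= 1 /\ t = vnorm (mat_app M x)) r.

Definition mat_nonzero (m n : nat) (M : mat m n) : Prop := exists i j, M i j <> 0.

Definition lacunary (m n : nat) (M : nat -> mat m n) : Prop :=
  (forall k, mat_nonzero (M k)) /\
  exists q, 1 < q /\ forall k r r', is_opnorm (M k) r -> is_opnorm (M (S k)) r' ->
    q <= r' / r.

Definition unif_discrete (m : nat) (Z : nat -> vec m -> Prop) : Prop :=
  exists delta, 0 < delta /\
    forall k x y, Z k x -> Z k y -> x <> y -> delta < dist x y.

Definition Etilde (m n : nat) (M : nat -> mat m n) (Z : nat -> vec m -> Prop)
  : vec n -> Prop :=
  fun x => exists eps, 0 < eps /\
    forall k z, Z k z -> eps <= dist (mat_app (M k) x) z.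

Definition set (n : nat) := vec n -> Prop.

Definition oball (n : nat) (x : vec n) (r : R) : set n := fun y => dist x y < r.
Definition cball (n : nat) (x : vec n) (r : R) : set n := fun y => dist x y <= r.

Definition is_open (n : nat) (U : set n) : Prop :=
  forall x, U x -> exists r, 0 < r /\ forall y, oball x r y -> U y.

Inductive borel (n : nat) : set n -> Prop :=
| borel_open U : is_open U -> borel U
| borel_compl A : borel A -> borel (fun x => ~ A x)
| borel_union (A : nat -> set n) : (forall i, borel (A i)) -> borel (fun x => exists i, A i x)
| borel_ext A B : borel A -> (forall x, A x <-> B x) -> borel B.

(* extended nonnegative reals [0, +oo] *)
Inductive ereal := Fin (r : R) | PInf.

Definition elt (a b : ereal) : Prop :=
  match a, b with
  | Fin x, Fin y => x < y
  | Fin _, PInf => True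
  | PInf, _ => False
  end.

(* multiplication of an extended value by a (positive) real *)
Definition escale (c : R) (a : ereal) : ereal :=
  match a with Fin x => Fin (c * x) | PInf => PInf end.

Definition esum_is (f : nat -> ereal) (s : ereal) : Prop :=
  match s with
  | Fin l => exists g : nat -> R, (forall i, f i = Fin (g i)) /\
               Un_cv (fun N => sum_f_R0 g N) l
  | PInf => ~ exists (g : nat -> R) (l : R), (forall i, f i = Fin (g i)) /\
               Un_cv (fun N => sum_f_R0 g N) l
  end.

(* mu is a Borel measure on R^n (only its values on Borel sets matter) *)
Definition borel_measure (n : nat) (mu : set n -> ereal) : Prop :=
  mu (fun _ => False) = Fin 0 /\
  (forall A, borel A -> forall r, mu A = Fin r -> 0 <= r) /\
  (forall A : nat -> set n, (forall i, borel (A i)) ->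
     (forall i j x, i <> j -> A i x -> A j x -> False) ->
     esum_is (fun i => mu (A i)) (mu (fun x => exists i, A i x))).

Definition locally_finite (n : nat) (mu : set n -> ereal) : Prop :=
  forall x, exists r, 0 < r /\ exists v, mu (oball x r) = Fin v.

Definition supp (n : nat) (mu : set n -> ereal) : set n :=
  fun x => forall r, 0 < r -> elt (Fin 0) (mu (oball x r)).

Definition dot (n : nat) (a x : vec n) : R := rsum (fun i => a i * x i).

(* affine hyperplane { x : a.x = b }, a <> 0 *)
Definition hyperplane (n : nat) (a : vec n) (b : R) : set n := fun x => dot a x = b.

(* eps-neighbourhood {x : d(x,L) <= eps}, with d(x,L) = inf_{y in L} d(x,y) *)
Definition nbhd (n : nat) (L : set n) (eps : R) : set n :=
  fun x => forall t, 0 < t -> exists y, L y /\ dist x y < eps + t.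

Definition abs_decaying (n : nat) (mu : set n -> ereal) (C gam : R) : Prop :=
  exists rho0, 0 < rho0 /\
    forall (a : vec n) (b : R), (exists i, a i <> 0) ->
    forall x, supp mu x -> forall rho eps, 0 < rho -> rho < rho0 -> 0 < eps ->
      elt (mu (fun y => cball x rho y /\ nbhd (hyperplane a b) eps y))
          (escale (C * Rpower (eps / rho) gam) (mu (cball x rho))).

(* a move (x, rho) stands for the ball {x' in K : d(x,x') <= rho} *)
Definition move (n : nat) := (vec n * R)%type.

Definition le_s (n : nat) (w2 w1 : move n) : Prop :=
  w2.2 + dist w1.1 w2.1 <= w1.2.

Definition in_ball (n : nat) (K : set n) (w : move n) : set n :=
  fun y => K y /\ dist w.1 y <= w.2.

(* Alice's strategy: from the list [w_1; ...; w_k] of Bob's moves so far,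
   produce omega'_k. *)
Definition strategy (n : nat) := seq (move n) -> move n.

Definition ab_winning (n : nat) (K : set n) (alpha beta : R) (S : set n) : Prop :=
  exists sigma : strategy n,
  forall b : nat -> move n,
    let a := fun k => sigma (mkseq b k.+1) in
    K (b 0%nat).1 -> 0 < (b 0%nat).2 ->
    (forall k, (forall j, (j < k)%nat ->
          K (b j.+1).1 /\ (b j.+1).2 = beta * (a j).2 /\ le_s (b j.+1) (a j)) ->
        K (a k).1 /\ (a k).2 = alpha * (b k).2 /\ le_s (a k) (b k)) /\
    ((forall j, K (b j.+1).1 /\ (b j.+1).2 = beta * (a j).2 /\ le_s (b j.+1) (a j)) ->
     forall x, (forall k, in_ball K (b k) x) -> S x /\ K x).

Definition alpha_winning (n : nat) (K : set n) (alpha : R) (S : set n) : Prop :=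
  forall beta, 0 < beta < 1 -> ab_winning K alpha beta S.

(* Main.v *)
From HB Require Import structures.
From Stdlib Require Import Reals Lra Lia Classical ClassicalEpsilon.
From Stdlib Require Import FunctionalExtensionality PropExtensionality.
From mathcomp Require Import all_boot.
Require Import Defs.
Set Implicit Arguments.
Unset Strict Implicit.
Unset Printing Implicit Defensive.
Local Open Scope R_scope.

(** Let [t_k] be the operator norm of [M_k] and [s = alpha beta] the factor by
    which Bob's radius shrinks in a round.  Call [k] alive for a ball [(x, r)] when
    [t_k r <= delta / 4] and the ball still contains a point [y] with [M_k y]
    within [O(t_k r)] of [Z_k].  By discreteness only one point of [Z_k] matters
    then, and the points mapped near it lie in a neighbourhood of a hyperplane
    orthogonal to a longest row of [M_k].

    Since [C (2 alpha / (1 - alpha))^gam < 1], absolute decay gives, by averaging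
    over a ball centred on the support, a legal move for Alice that kills a fixed
    proportion [1 - p] of any weighted finite family of hyperplanes.  She applies
    it to the indices alive for Bob's current ball, with weights
    [(t_k r)^(- theta)], where [theta] is so small that [s^(- theta) p < 1].
    Lacunarity bounds the weight of the indices that become relevant in one
    round, so the total weight stays bounded.  Hence no [k] is alive once [t_k r]
    is below a fixed threshold, and this keeps [M_k x] uniformly away from [Z_k]. *)

(** * Euclidean geometry *)

HB.instance Definition _ := Monoid.isComLaw.Build R R0 Rplus
  (fun x y z => esym (Rplus_assoc x y z)) Rplus_comm Rplus_0_l.

Lemma eq_rsum n (f g : 'I_n -> R) : (forall i, f i = g i) -> rsum f = rsum g.
Proof. by move=> fg; apply: eq_bigr. Qed.

Lemma rsumD n (f g : 'I_n -> R) : rsum (fun i => f i + g i) = rsum f + rsum g.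
Proof. by rewrite /rsum big_split. Qed.

Lemma rsumZ n c (f : 'I_n -> R) : rsum (fun i => c * f i) = c * rsum f.
Proof.
rewrite /rsum (big_morph (Rmult c) (id1 := R0) (op1 := Rplus)) //.
- by move=> x y; ring.
- by ring.
Qed.

Lemma rsum_le n (f g : 'I_n -> R) : (forall i, f i <= g i) -> rsum f <= rsum g.
Proof. by move=> fg; apply: (big_ind2 Rle) => // *; lra. Qed.

Lemma rsum_ge0 n (f : 'I_n -> R) : (forall i, 0 <= f i) -> 0 <= rsum f.
Proof. by move=> f0; apply: big_ind => [|u v *|i _] //; [exact: Rle_refl|lra]. Qed.

Lemma rsum_ge_term n (f : 'I_n -> R) i : (forall j, 0 <= f j) -> f i <= rsum f.
Proof.
move=> f0; rewrite /rsum (bigD1 i) //= -{1}(Rplus_0_r (f i)).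
apply: Rplus_le_compat_l.
by apply: big_ind => [|u v *|j _] //; [exact: Rle_refl|lra].
Qed.

Lemma rsum_const n c : rsum (fun _ : 'I_n => c) = INR n * c.
Proof.
elim: n => [|n IH]; rewrite /rsum; first by rewrite big_ord0 /=; ring.
by rewrite big_ord_recr S_INR -/(rsum (fun _ : 'I_n => c)) IH /=; ring.
Qed.

Lemma rsum_ord0 (f : 'I_0 -> R) : rsum f = 0.
Proof. by rewrite /rsum big_ord0. Qed.

Lemma rsum_recr (f : nat -> R) n :
  rsum (fun i : 'I_n.+1 => f i) = rsum (fun i : 'I_n => f i) + f n.
Proof. by rewrite /rsum big_ord_recr. Qed.

Lemma rsum_trunc (f : nat -> R) N0 N :
  (forall k, 0 <= f k) -> (forall k, (N0 <= k)%N -> f k = 0) ->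
  rsum (fun k : 'I_N => f k) <= rsum (fun k : 'I_N0 => f k).
Proof.
move=> f0 ft.
have grow : forall d, rsum (fun k : 'I_(N0 + d) => f k) = rsum (fun k : 'I_N0 => f k).
  elim=> [|d IH]; first by rewrite addn0.
  by rewrite addnS rsum_recr IH ft ?leq_addr // Rplus_0_r.
have mono : forall d, rsum (fun k : 'I_N => f k) <= rsum (fun k : 'I_(N + d) => f k).
  elim=> [|d IH]; first by rewrite addn0; lra.
  by rewrite addnS rsum_recr; have := f0 (N + d)%N; lra.
by rewrite -(grow N) addnC; apply: mono.
Qed.

(** With [A], [B] the squared norms and [D] the dot product, the squared norm of [B x - D y] expands
    to [B (A B - D^2)]; if [B = 0] then [y] vanishes. *)
Lemma cauchy_schwarz n (x y : vec n) :
  dot x y ^ 2 <= rsum (fun i => x i ^ 2) * rsum (fun i => y i ^ 2).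
Proof.
set A := rsum _; set B := rsum _; set D := dot x y.
have B0 : 0 <= B by apply: rsum_ge0 => i; apply: pow2_ge_0.
have A0 : 0 <= A by apply: rsum_ge0 => i; apply: pow2_ge_0.
have key : 0 <= B * (A * B - D ^ 2).
  have -> : B * (A * B - D ^ 2) = rsum (fun i => (B * x i - D * y i) ^ 2).
    rewrite (eq_rsum (g := fun i => B ^ 2 * x i ^ 2 + ((- 2 * B * D) * (x i * y i)
       + D ^ 2 * y i ^ 2))); last by move=> i; ring.
    by rewrite !rsumD !rsumZ -/A -/B -/(dot x y) -/D; ring.
  by apply: rsum_ge0 => i; apply: pow2_ge_0.
case: (Rle_lt_or_eq_dec _ _ B0) => [Bp|B0'].
  have : 0 <= A * B - D ^ 2 by apply: (Rmult_le_reg_l B) => //; rewrite Rmult_0_r.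
  lra.
have y0 i : y i = 0.
  have : y i ^ 2 <= B by apply: (rsum_ge_term (f := fun i => y i ^ 2)) => j; apply: pow2_ge_0.
  rewrite -B0' => h.
  by case: (Req_dec (y i) 0) => // yi; have := pow_nonzero _ 2 yi; have := pow2_ge_0 (y i); lra.
have -> : D = 0.
  rewrite /D /dot (eq_rsum (g := fun i => 0 * x i)); last by move=> i; rewrite y0; ring.
  by rewrite rsumZ; ring.
by rewrite -B0'; lra.
Qed.

Lemma vnorm_ge0 n (x : vec n) : 0 <= vnorm x.
Proof. exact: sqrt_pos. Qed.

Lemma vnorm_sq n (x : vec n) : vnorm x ^ 2 = rsum (fun i => x i ^ 2).
Proof. by rewrite /vnorm pow2_sqrt //; apply: rsum_ge0 => i; apply: pow2_ge_0. Qed.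


Lemma Rle_sq x y : 0 <= y -> x ^ 2 <= y ^ 2 -> x <= y.
Proof. by move=> y0 h; case: (Rle_lt_dec x y) => // yx; nra. Qed.

Lemma dot_self n (a : vec n) : dot a a = vnorm a ^ 2.
Proof. by rewrite vnorm_sq /dot; apply: eq_rsum => i; ring. Qed.

Lemma dot_le n (x y : vec n) : Rabs (dot x y) <= vnorm x * vnorm y.
Proof.
apply: Rle_sq; first by apply: Rmult_le_pos; apply: vnorm_ge0.
by rewrite pow2_abs Rpow_mult_distr !vnorm_sq; apply: cauchy_schwarz.
Qed.

Lemma vnormD n (x y : vec n) : vnorm (fun i => x i + y i) <= vnorm x + vnorm y.
Proof.
apply: Rle_sq; first by apply: Rplus_le_le_0_compat; apply: vnorm_ge0.
rewrite vnorm_sq (eq_rsum (g := fun i => x i ^ 2 + (2 * (x i * y i) + y i ^ 2)));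
  last by move=> i; ring.
rewrite !rsumD rsumZ -!vnorm_sq -/(dot x y).
by have := dot_le x y; have := Rle_abs (dot x y); nra.
Qed.

Lemma vnormZ n c (x : vec n) : vnorm (fun i => c * x i) = Rabs c * vnorm x.
Proof.
rewrite {1}/vnorm (eq_rsum (g := fun i => c ^ 2 * x i ^ 2)); last by move=> i; ring.
by rewrite rsumZ sqrt_mult_alt; [rewrite -Rsqr_pow2 sqrt_Rsqr_abs | apply: pow2_ge_0].
Qed.

Lemma vnorm0 n : vnorm (fun _ : 'I_n => 0) = 0.
Proof.
rewrite /vnorm (eq_rsum (g := fun _ => 0)); last by move=> i; ring.
by rewrite rsum_const Rmult_0_r sqrt_0.
Qed.

Lemma distE n (x y : vec n) : dist x y = vnorm (fun i => x i - y i).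
Proof. by []. Qed.

Lemma dist_sym n (x y : vec n) : dist x y = dist y x.
Proof. by rewrite /dist; congr sqrt; apply: eq_rsum => i; ring. Qed.

Lemma dist_tri n (y x z : vec n) : dist x z <= dist x y + dist y z.
Proof.
rewrite !distE.
have -> : (fun i => x i - z i) = (fun i => (x i - y i) + (y i - z i)).
  by apply: functional_extensionality => i; ring.
exact: vnormD.
Qed.

Lemma distxx n (x : vec n) : dist x x = 0.
Proof.
rewrite /dist (eq_rsum (g := fun _ => 0)); last by move=> i; ring.
by rewrite rsum_const Rmult_0_r sqrt_0.
Qed.

Lemma dotD n (a x y : vec n) : dot a (fun i => x i + y i) = dot a x + dot a y.
Proof. by rewrite /dot -rsumD; apply: eq_rsum => i; ring. Qed.

Lemma dotZ n (a x : vec n) c : dot a (fun i => c * x i) = c * dot a x.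
Proof. by rewrite /dot -rsumZ; apply: eq_rsum => i; ring. Qed.

Lemma dotB n (a x y : vec n) : dot a (fun i => x i - y i) = dot a x - dot a y.
Proof.
rewrite (_ : dot a x - dot a y = dot a x + (-1) * dot a y); last by ring.
by rewrite -dotZ -dotD /dot; apply: eq_rsum => i; ring.
Qed.

Lemma coord_le_vnorm n (x : vec n) i : Rabs (x i) <= vnorm x.
Proof.
apply: Rle_sq; first exact: vnorm_ge0.
rewrite pow2_abs vnorm_sq.
by apply: (rsum_ge_term (f := fun i => x i ^ 2)) => j; apply: pow2_ge_0.
Qed.

Lemma mat_appB m n (M : mat m n) (x y : vec n) :
  mat_app M (fun i => x i - y i) = (fun i => mat_app M x i - mat_app M y i).
Proof. by apply: functional_extensionality => i; apply: (dotB (M i)). Qed.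

Lemma mat_appZ m n (M : mat m n) c (x : vec n) :
  mat_app M (fun i => c * x i) = (fun i => c * mat_app M x i).
Proof. by apply: functional_extensionality => i; apply: (dotZ (M i)). Qed.

Lemma vnorm_eq0 n (x : vec n) : vnorm x = 0 -> forall i, x i = 0.
Proof.
move=> x0 i; have := coord_le_vnorm x i; rewrite x0.
by have := Rabs_pos (x i); case: (Req_dec (x i) 0) => // /Rabs_pos_lt; lra.
Qed.

Lemma not_nbhd_hyperplane n (a : vec n) b eps (y : vec n) :
  0 < vnorm a -> ~ nbhd (hyperplane a b) eps y -> eps * vnorm a < Rabs (dot a y - b).
Proof.
move=> a0 ny; apply: Rnot_le_lt => h; apply: ny => t t0.
(* Subtracting [c a] from [y] gives the foot of the perpendicular, at distance |a.y - b| / |a|. *)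
set c := (dot a y - b) / vnorm a ^ 2.
exists (fun i => y i - c * a i); split.
  by rewrite /hyperplane dotB dotZ dot_self /c; field; lra.
rewrite distE (_ : (fun i => _) = (fun i => c * a i)); last first.
  by apply: functional_extensionality => i; ring.
rewrite vnormZ.
suff : Rabs c * vnorm a <= eps by lra.
apply: (Rmult_le_reg_r (vnorm a)) => //; apply: Rle_trans h.
rewrite /c /Rdiv Rabs_mult (Rabs_pos_eq (/ _)); last first.
  by apply: Rlt_le; apply: Rinv_0_lt_compat; apply: pow_lt.
by right; field; lra.
Qed.

(** * Operator norms and long rows *)

Lemma opnorm_exists m n (M : mat m n) : exists r, is_opnorm M r.
Proof.
have [||r hr] := completeness
  (fun t => exists x : vec n, vnorm x <= 1 /\ t = vnorm (mat_app M x)); last by exists r.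
(* The Frobenius norm is an upper bound, by Cauchy-Schwarz on each row. *)
- exists (sqrt (rsum (fun i => vnorm (M i) ^ 2))) => t [x [x1 ->]].
  apply: sqrt_le_1_alt; apply: rsum_le => i.
  rewrite -(pow2_abs (mat_app M x i)) -!Rsqr_pow2; apply: Rsqr_incr_1.
  + have := dot_le (M i) x; rewrite /mat_app -/(dot (M i) x).
    by have := vnorm_ge0 (M i); have := vnorm_ge0 x; nra.
  + exact: Rabs_pos.
  + exact: vnorm_ge0.
- by exists (vnorm (mat_app M (fun _ => 0))), (fun _ => 0); rewrite vnorm0; split => //; lra.
Qed.

Lemma opnorm_bound m n (M : mat m n) r (x : vec n) :
  is_opnorm M r -> vnorm (mat_app M x) <= r * vnorm x.
Proof.
move=> [ub _]; have x0 := vnorm_ge0 x.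
case: (Req_dec (vnorm x) 0) => [xz|xnz].
  have -> : x = (fun i => 0 * x i).
    by apply: functional_extensionality => i; rewrite (vnorm_eq0 xz); ring.
  by rewrite mat_appZ !vnormZ Rabs_R0; lra.
have : vnorm (mat_app M (fun i => / vnorm x * x i)) <= r.
  apply: ub; exists (fun i => / vnorm x * x i); split => //.
  rewrite vnormZ Rabs_pos_eq; last by apply: Rlt_le; apply: Rinv_0_lt_compat; lra.
  by right; field.
rewrite mat_appZ vnormZ Rabs_pos_eq; last by apply: Rlt_le; apply: Rinv_0_lt_compat; lra.
move=> h; apply: (Rmult_le_reg_l (/ vnorm x)); first by apply: Rinv_0_lt_compat; lra.
by apply: Rle_trans h _; right; field.
Qed.

Lemma dist_mat_app m n (M : mat m n) r (x y : vec n) :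
  is_opnorm M r -> dist (mat_app M x) (mat_app M y) <= r * dist x y.
Proof. by move=> hr; rewrite !distE -mat_appB; apply: opnorm_bound. Qed.

Lemma opnorm_gt0 m n (M : mat m n) r : mat_nonzero M -> is_opnorm M r -> 0 < r.
Proof.
move=> [i [j Mij]] hr.
have r0 : 0 <= r.
  apply: Rle_trans (vnorm_ge0 (mat_app M (fun _ => 0))) _.
  by apply: (proj1 hr); exists (fun _ => 0); rewrite vnorm0; split => //; lra.
case: (Rle_lt_or_eq_dec _ _ r0) => // rz; exfalso; apply: Mij.
(* If the norm were zero, [M] would kill its own [i]-th row; the [i]-th coordinate of that image is
   the squared length of the row. *)
have h := opnorm_bound (M i) hr; rewrite -rz Rmult_0_l in h.
have := Rle_trans _ _ _ (coord_le_vnorm _ i) h.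
rewrite /mat_app -/(dot (M i) (M i)) dot_self Rabs_pos_eq; last exact: pow2_ge_0.
move=> h2; apply: vnorm_eq0.
by have := vnorm_ge0 (M i); nra.
Qed.

(** If every row were shorter, the image of the unit ball would have norm at most [r / 2], against
    [r] being the least upper bound. *)
Lemma opnorm_row m n (M : mat m n) r : mat_nonzero M -> is_opnorm M r ->
  exists i, r / (2 * sqrt (INR m)) <= vnorm (M i).
Proof.
move=> nz hr; have r0 := opnorm_gt0 nz hr.
case: (classic (exists i, r / (2 * sqrt (INR m)) <= vnorm (M i))) => // hn.
exfalso.
have m0 : 0 < INR m.
  case: nz => i _; apply: lt_0_INR; apply/ltP; exact: leq_ltn_trans (ltn_ord i).
have sm : 0 < sqrt (INR m) by apply: sqrt_lt_R0.
suff : r <= r / 2 by lra.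
apply: (proj2 hr) => t [x [x1 ->]].
apply: Rle_sq; first by lra.
rewrite vnorm_sq.
have -> : (r / 2) ^ 2 = rsum (fun _ : 'I_m => (r / (2 * sqrt (INR m))) ^ 2).
  rewrite rsum_const.
  have e : INR m = sqrt (INR m) ^ 2 by rewrite pow2_sqrt //; lra.
  by rewrite {1}e; field; lra.
apply: rsum_le => i.
have hi : vnorm (M i) < r / (2 * sqrt (INR m)).
  by apply: Rnot_le_lt => h; apply: hn; exists i.
rewrite -(pow2_abs (mat_app M x i)) -!Rsqr_pow2; apply: Rsqr_incr_1.
- have := dot_le (M i) x; rewrite /mat_app -/(dot (M i) x).
  by have := vnorm_ge0 (M i); have := vnorm_ge0 x; nra.
- exact: Rabs_pos.
- by have := vnorm_ge0 (M i); lra.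
Qed.

(** * Borel measures and their supports *)

Lemma set_ext n (A B : set n) : (forall x, A x <-> B x) -> A = B.
Proof.
by move=> h; apply: functional_extensionality => x; apply: propositional_extensionality.
Qed.

Definition ind (P : Prop) : R := if excluded_middle_informative P then 1 else 0.

Lemma ind1 (P : Prop) : P -> ind P = 1.
Proof. by rewrite /ind; case: excluded_middle_informative. Qed.

Lemma ind0 (P : Prop) : ~ P -> ind P = 0.
Proof. by rewrite /ind; case: excluded_middle_informative. Qed.

Lemma ind_bound (P : Prop) : 0 <= ind P <= 1.
Proof. by rewrite /ind; case: excluded_middle_informative => h /=; lra. Qed.

Lemma borel_set0 n : borel (fun _ : vec n => False).
Proof. by apply: borel_open. Qed.

Lemma borelU n (A B : set n) : borel A -> borel B -> borel (fun x => A x \/ B x).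
Proof.
move=> bA bB.
apply: (@borel_ext _ (fun x => exists i : nat, (if i is 0%N then A else B) x)).
  by apply: borel_union; case.
move=> x; split; first by case; case=> [|i] h; [left|right].
by case=> h; [exists 0%N|exists 1%N].
Qed.

Lemma borelI n (A B : set n) : borel A -> borel B -> borel (fun x => A x /\ B x).
Proof.
move=> bA bB.
apply: (@borel_ext _ (fun x => ~ (~ A x \/ ~ B x))).
  by apply: borel_compl; apply: borelU; apply: borel_compl.
by move=> x; split; [move/not_or_and => [/NNPP ? /NNPP ?]|tauto].
Qed.

Lemma borelD n (A B : set n) : borel A -> borel B -> borel (fun x => A x /\ ~ B x).
Proof. by move=> bA bB; apply: borelI => //; apply: borel_compl. Qed.

Lemma oball_open n (x : vec n) r : is_open (oball x r).
Proof.
move=> y xy; exists (r - dist x y); split; first by move: xy; rewrite /oball; lra.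
by move=> z; rewrite /oball => yz; have := dist_tri y x z; lra.
Qed.

Lemma borel_closed n (A : set n) : is_open (fun x => ~ A x) -> borel A.
Proof.
move=> oA; apply: (@borel_ext _ (fun x => ~ ~ A x)); last by move=> x; split; [exact: NNPP|tauto].
by apply: borel_compl; apply: borel_open.
Qed.

Lemma borel_cball n (x : vec n) r : borel (cball x r).
Proof.
apply: borel_closed => y; rewrite /cball => /Rnot_le_lt xy.
exists (dist x y - r); split; first by lra.
move=> z; rewrite /oball => yz xz; have := dist_tri z x y.
by rewrite (dist_sym z y); lra.
Qed.

Lemma borel_nbhd n (L : set n) eps : borel (nbhd L eps).
Proof.
apply: borel_closed => y ny.
have [t ht] := not_all_ex_not _ _ ny; have [t0 h] := imply_to_and _ _ ht.
exists (t / 2); split; first by lra.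
move=> z; rewrite /oball => yz hz; have [|u [Lu zu]] := hz (t / 2); first by lra.
by apply: h; exists u; split => //; have := dist_tri z y u; lra.
Qed.

Lemma Un_cv_eventually_const u l c N0 :
  (forall N, (N0 <= N)%N -> u N = c) -> Un_cv u l -> l = c.
Proof.
move=> uc ul; apply: (UL_sequence _ _ _ ul) => eps eps0; exists N0 => N /leP hN.
by rewrite uc // R_dist_eq.
Qed.

(** The value at infinity is a default: the sets measured this way below all have finite measure. *)
Definition mreal n (mu : set n -> ereal) (A : set n) : R :=
  if mu A is Fin r then r else 0.

Lemma mu_add n (mu : set n -> ereal) (A B : set n) l : borel_measure mu ->
  borel A -> borel B -> (forall x, A x -> B x -> False) ->
  mu (fun x => A x \/ B x) = Fin l ->
  exists a b, [/\ mu A = Fin a, mu B = Fin b, 0 <= a, 0 <= b & l = a + b].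
Proof.
move=> [mu0 [pos add]] bA bB dis hl.
(* Countable additivity is applied to [A], [B] followed by empty sets, so the partial sums are
   constant from index 1 on. *)
pose S (i : nat) : set n := match i with 0%N => A | 1%N => B | _ => fun _ => False end.
have bS i : borel (S i) by case: i => [|[|i]] //=; apply: borel_set0.
have dS i j x : i <> j -> S i x -> S j x -> False.
  by case: i j => [|[|i]] [|[|j]] //= _ h1 h2; apply: (dis x).
have := add S bS dS.
have -> : (fun x => exists i, S i x) = (fun x => A x \/ B x).
  apply: set_ext => x; split; first by case=> [[|[|i]]] h //; [left|right].
  by case=> h; [exists 0%N|exists 1%N].
rewrite hl /= => -[g [gS cv]].
exists (g 0%N), (g 1%N); split; try by rewrite -gS.
- by apply: (pos A bA); rewrite -gS.
- by apply: (pos B bB); rewrite -gS.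
apply: (Un_cv_eventually_const (N0 := 1%N) _ cv) => N; elim: N => // -[_ _|N IH _] //.
rewrite /= -/(sum_f_R0 g N.+1) IH //.
have : Fin (g N.+2) = Fin 0 by rewrite -gS /= mu0.
by case=> ->; lra.
Qed.

Lemma mu_split n (mu : set n -> ereal) (E H : set n) e : borel_measure mu ->
  borel E -> borel H -> mu E = Fin e ->
  exists a b, [/\ mu (fun x => E x /\ H x) = Fin a,
    mu (fun x => E x /\ ~ H x) = Fin b, 0 <= a, 0 <= b & e = a + b].
Proof.
move=> hmu bE bH he; apply: mu_add => //.
- exact: borelI.
- exact: borelD.
- by move=> x [_ h] [_ h'].
- by rewrite -he; congr mu; apply: set_ext => x; split; [tauto|case: (classic (H x)); tauto].
Qed.

Lemma mu_mono n (mu : set n -> ereal) (A E : set n) e : borel_measure mu ->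
  borel A -> borel E -> (forall x, A x -> E x) -> mu E = Fin e ->
  exists2 a, mu A = Fin a & 0 <= a <= e.
Proof.
move=> hmu bA bE AE he; have [a [b [ha hb a0 b0 eab]]] := mu_split hmu bE bA he.
exists a; last by lra.
by rewrite -ha; congr mu; apply: set_ext => x; split; [move=> h; split; auto|tauto].
Qed.

(* Integrating the pointwise bound [v <= \sum w_k 1_(H_k)] over [E]; the
   simple function is integrated by splitting [E] along one [H_k] at a time. *)
Lemma mu_sum_ge n (mu : set n -> ereal) (w : nat -> R) (H : nat -> set n) N :
  borel_measure mu -> (forall k, borel (H k)) ->
  forall (E : set n) v e, borel E -> mu E = Fin e ->
  (forall y, E y -> v <= rsum (fun k : 'I_N => w k * ind (H k y))) ->
  v * e <= rsum (fun k : 'I_N => w k * mreal mu (fun y => E y /\ H k y)).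
Proof.
move=> hmu bH; elim: N => [|N IH] E v e bE he hv.
  rewrite rsum_ord0.
  have e0 := proj1 (proj2 hmu) E bE e he.
  case: (classic (exists y, E y)) => [[y Ey]|nE].
    have := hv y Ey; rewrite rsum_ord0 => v0.
    by have : 0 <= (- v) * e; [apply: Rmult_le_pos; lra|lra].
  have E0 : E = (fun _ => False) by apply: set_ext => y; split => // Ey; apply: nE; exists y.
  by move: he; rewrite E0 (proj1 hmu) => -[<-]; lra.
have [a [b [ha hb a0 b0 eab]]] := mu_split hmu bE (bH N) he.
(* On [H N] the last term contributes [w N], leaving the lower bound [v - w N] for the others; off
   [H N] it contributes nothing. *)
have IH1 := IH (fun y => E y /\ H N y) (v - w N) a (borelI bE (bH N)) ha.
have IH2 := IH (fun y => E y /\ ~ H N y) v b (borelD bE (bH N)) hb.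
rewrite (rsum_recr (fun k => w k * mreal mu (fun y => E y /\ H k y))).
rewrite {2}/mreal ha.
have -> : rsum (fun k : 'I_N => w k * mreal mu (fun y => E y /\ H k y)) =
   rsum (fun k : 'I_N => w k * mreal mu (fun y => (E y /\ H N y) /\ H k y)) +
   rsum (fun k : 'I_N => w k * mreal mu (fun y => (E y /\ ~ H N y) /\ H k y)).
  rewrite -rsumD; apply: eq_rsum => k.
  have [c hc _] := mu_mono hmu (borelI bE (bH k)) bE (fun x h => proj1 h) he.
  have [c1 [c2 [h1 h2 _ _ ec]]] := mu_split hmu (borelI bE (bH k)) (bH N) hc.
  rewrite -Rmult_plus_distr_l; congr (_ * _); rewrite {1}/mreal hc ec; congr (_ + _).
    rewrite /mreal (_ : (fun y => _) = (fun x => (E x /\ H k x) /\ H N x)) ?h1 //.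
    by apply: set_ext => y; tauto.
  rewrite /mreal (_ : (fun y => _) = (fun x => (E x /\ H k x) /\ ~ H N x)) ?h2 //.
  by apply: set_ext => y; tauto.
have {}IH1 : (v - w N) * a <=
   rsum (fun k : 'I_N => w k * mreal mu (fun y => (E y /\ H N y) /\ H k y)).
  apply: IH1 => y [Ey Hy]; have := hv y Ey.
  by rewrite (rsum_recr (fun k => w k * ind (H k y))) (ind1 Hy); lra.
have {}IH2 : v * b <=
   rsum (fun k : 'I_N => w k * mreal mu (fun y => (E y /\ ~ H N y) /\ H k y)).
  apply: IH2 => y [Ey Hy]; have := hv y Ey.
  by rewrite (rsum_recr (fun k => w k * ind (H k y))) (ind0 Hy); lra.
by rewrite eab; lra.
Qed.

(** * Null sets and the complement of the support *)

Lemma mu_null_union n (mu : set n -> ereal) (A : nat -> set n) : borel_measure mu ->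
  (forall i, borel (A i)) -> (forall i, mu (A i) = Fin 0) ->
  mu (fun x => exists i, A i x) = Fin 0.
Proof.
move=> hmu bA nA.
(* Removing the earlier sets makes the union disjoint without changing it. *)
pose B i x := A i x /\ ~ exists j, (if (j < i)%N then A j else fun _ => False) x.
have bB i : borel (B i).
  apply: borelD => //; apply: borel_union => j.
  by case: ifP => // _; apply: borel_set0.
have nB i : mu (B i) = Fin 0.
  have [a -> a0] := mu_mono hmu (bB i) (bA i) (fun x h => proj1 h) (nA i).
  by congr Fin; lra.
have dB i j x : i <> j -> B i x -> B j x -> False.
  move=> /eqP; rewrite neq_ltn => /orP [] ij [h1 h2] [h3 h4].
    by apply: h4; exists i; rewrite ij.
  by apply: h2; exists j; rewrite ij.
have := proj2 (proj2 hmu) B bB dB.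
have -> : (fun x => exists i, B i x) = (fun x => exists i, A i x).
  apply: set_ext => x; split; first by case=> i [h _]; exists i.
  case=> i; elim/ltn_ind: i => i IH Ai.
  case: (classic (exists j, (if (j < i)%N then A j else fun _ => False) x)) => h.
    by case: h => j; case: ifP => // ji Aj; apply: (IH j).
  by exists i.
case: (mu _) => [l /= [g [gB cv]]|/= ns].
  congr Fin; apply: (Un_cv_eventually_const (N0 := 0%N) _ cv) => N _.
  rewrite (PartSum.sum_eq _ (fun _ => 0)); last by move=> i _; have := gB i; rewrite nB => -[].
  by rewrite sum_cte; ring.
case: ns; exists (fun _ => 0), 0; split => // eps eps0; exists 0%N => N _.
by rewrite sum_cte Rmult_0_l R_dist_eq.
Qed.

(** Writing an integer as a difference of naturals keeps the codes of rational centres in a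
    countable type. *)
Lemma nat_diff_approx (u : R) : exists pq : nat * nat, Rabs (u - (INR pq.1 - INR pq.2)) <= 1.
Proof.
have [h1 h2] := archimed u.
exists (Z.to_nat (up u), Z.to_nat (- up u)) => /=.
have -> : INR (Z.to_nat (up u)) - INR (Z.to_nat (- up u)) = IZR (up u).
  rewrite !INR_IZR_INZ -minus_IZR; congr IZR; lia.
by apply: Rabs_le; lra.
Qed.

Lemma vnorm_le_coord n (x : vec n) h : 0 <= h -> (forall i, Rabs (x i) <= h) ->
  vnorm x <= INR n * h.
Proof.
move=> h0 hx; apply: Rle_sq; first by apply: Rmult_le_pos => //; apply: pos_INR.
rewrite vnorm_sq; apply: (@Rle_trans _ (rsum (fun _ : 'I_n => h ^ 2))).
  apply: rsum_le => i; rewrite -(pow2_abs (x i)); apply: pow_incr; split => //.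
  exact: Rabs_pos.
rewrite rsum_const Rpow_mult_distr; apply: Rmult_le_compat_r; first exact: pow2_ge_0.
case: n x hx => [|n] _ _; first by rewrite /=; lra.
by have := pos_INR n; rewrite S_INR; nra.
Qed.

(* Rational balls, coded by [nat]: the centre has coordinates [(p_i - q_i) / (k+1)]. *)
Definition code_ball n (c : {ffun 'I_n -> nat * nat} * nat) : set n :=
  oball (fun i => (INR (c.1 i).1 - INR (c.1 i).2) / INR c.2.+1)
        (INR n.+1 / INR c.2.+1).

(** Rounding each [(k+1) x_i] to an integer moves [x] by at most [n / (k+1)], strictly less than the
    radius [(n+1) / (k+1)]; [k] is taken so large that the diameter is below [r]. *)
Lemma code_ball_exists n (x : vec n) r : 0 < r ->
  exists c, code_ball c x /\ forall y, code_ball c y -> oball x r y.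
Proof.
move=> r0.
have [k hk] : exists k : nat, / INR k.+1 < r / (2 * INR n.+1).
  have [|k [hk k0]] := archimed_cor1 (r / (2 * INR n.+1)).
    apply: Rdiv_lt_0_compat => //; have := lt_0_INR n.+1 (Nat.lt_0_succ n); lra.
  exists k; apply: Rle_lt_trans hk.
  apply: Rinv_le_contravar; first exact: lt_0_INR.
  by rewrite S_INR; lra.
have k0 : 0 < INR k.+1 by apply: lt_0_INR; lia.
have n0 : 0 < INR n.+1 by apply: lt_0_INR; lia.
pose pq i := proj1_sig (constructive_indefinite_description _ (nat_diff_approx (INR k.+1 * x i))).
have hpq i : Rabs (INR k.+1 * x i - (INR (pq i).1 - INR (pq i).2)) <= 1.
  exact: (proj2_sig (constructive_indefinite_description _ (nat_diff_approx (INR k.+1 * x i)))).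
exists ([ffun i => pq i], k); rewrite /code_ball [(_, _).1]/= [(_, _).2]/=.
set c := (X in oball X _).
have cx : dist c x < INR n.+1 / INR k.+1.
  rewrite dist_sym distE.
  apply: (@Rle_lt_trans _ (INR n * / INR k.+1)).
    apply: vnorm_le_coord => [|i]; first by apply: Rlt_le; apply: Rinv_0_lt_compat.
    have cE : c i = (INR (pq i).1 - INR (pq i).2) / INR k.+1 by rewrite /c ffunE.
    rewrite cE (_ : x i - _ = / INR k.+1 * (INR k.+1 * x i - (INR (pq i).1 - INR (pq i).2)));
      last by field; lra.
    rewrite Rabs_mult Rabs_pos_eq; last by apply: Rlt_le; apply: Rinv_0_lt_compat.
    rewrite -{2}(Rmult_1_r (/ _)); apply: Rmult_le_compat_l => //.
    by apply: Rlt_le; apply: Rinv_0_lt_compat.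
  apply: Rmult_lt_compat_r; first exact: Rinv_0_lt_compat.
  by rewrite S_INR; lra.
split => // y; rewrite /oball => cy.
apply: (Rle_lt_trans _ _ _ (dist_tri c x y)); rewrite (dist_sym x c).
have : INR n.+1 / INR k.+1 < r / 2; last by lra.
apply: (@Rlt_le_trans _ (INR n.+1 * (r / (2 * INR n.+1)))).
  exact: Rmult_lt_compat_l.
by right; field; lra.
Qed.

(** The complement of the support is the union of the null rational balls, and these are countably
    many. *)
Lemma supp_full n (mu : set n -> ereal) : borel_measure mu ->
  borel (fun x => ~ supp mu x) /\ mu (fun x => ~ supp mu x) = Fin 0.
Proof.
move=> hmu.
pose D (j : nat) : set n :=
  match unpickle j with
  | Some c => if excluded_middle_informative (mu (code_ball c) = Fin 0) then code_ball c
              else fun _ => False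
  | None => fun _ => False
  end.
have bD j : borel (D j).
  rewrite /D; case: unpickle => [c|]; last exact: borel_set0.
  case: excluded_middle_informative => h; last exact: borel_set0.
  by apply: borel_open; apply: oball_open.
have nD j : mu (D j) = Fin 0.
  rewrite /D; case: unpickle => [c|]; last by case: hmu.
  by case: excluded_middle_informative => // h; case: hmu.
have -> : (fun x => ~ supp mu x) = (fun x => exists j, D j x).
  apply: set_ext => x; split.
    move=> nx; have [r hr'] := not_all_ex_not _ _ nx.
    have [r0 hr] := imply_to_and _ _ hr'.
    have [c [cx cr]] := code_ball_exists x r0.
    have mr : mu (oball x r) = Fin 0.
      move: hr (proj1 (proj2 hmu) (oball x r) (borel_open (oball_open (x:=x) (r:=r)))).
      case: (mu (oball x r)) => [v /= hv /(_ v erefl) v0|/= []] //.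
      by congr Fin; lra.
    have mc : mu (code_ball c) = Fin 0.
      have [a -> a0] := mu_mono hmu (borel_open (oball_open (n := n) (x:=_) (r:=_)))
        (borel_open (oball_open (x:=x) (r:=r))) cr mr.
      by congr Fin; lra.
    exists (pickle c); rewrite /D pickleK.
    by case: excluded_middle_informative.
  case=> j Djx sx.
  have [r [r0 hr]] : exists r, 0 < r /\ forall y, oball x r y -> D j y.
    move: Djx; rewrite /D; case: unpickle => // c.
    by case: excluded_middle_informative => // h; apply: oball_open.
  have [a ha a0] := mu_mono hmu (borel_open (oball_open (x:=x) (r:=r))) (bD j) hr (nD j).
  by have := sx r r0; rewrite ha /=; lra.
split; first exact: borel_union.
exact: mu_null_union.
Qed.

Lemma mu_supp n (mu : set n -> ereal) (E : set n) e : borel_measure mu ->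
  borel E -> mu E = Fin e ->
  borel (fun x => E x /\ supp mu x) /\ mu (fun x => E x /\ supp mu x) = Fin e.
Proof.
move=> hmu bE he; have [bS nS] := supp_full hmu.
have [a [b [ha hb a0 b0 ->]]] := mu_split hmu bE bS he.
have [c hc c0] := mu_mono hmu (borelI bE bS) bS (fun x h => proj2 h) nS.
have -> : (fun x => E x /\ supp mu x) = (fun x => E x /\ ~ ~ supp mu x).
  by apply: set_ext => x; split => -[h1 h2]; split => //; apply: NNPP.
split; first by apply: borelD.
rewrite hb; congr Fin; move: hc; rewrite ha => -[ac]; lra.
Qed.

(** If no point worked, integrating over the part of [E] in the support, which has full measure,
    would give [p' W e <= p e W] for the total weight [W]. Then [W = 0], and any point of that part
    works. *)
Lemma supp_avoids_on_average n (mu : set n -> ereal) (E : set n) e (w : nat -> R)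
    (H : nat -> set n) N p p' :
  borel_measure mu -> borel E -> mu E = Fin e -> 0 < e ->
  (forall k, borel (H k)) -> (forall k, 0 <= w k) -> p < p' ->
  (forall k, mreal mu (fun y => E y /\ H k y) <= p * e) ->
  exists y, [/\ E y, supp mu y &
    rsum (fun k : 'I_N => w k * ind (H k y)) <= p' * rsum (fun k : 'I_N => w k)].
Proof.
move=> hmu bE he e0 bH w0 pp hp; apply: NNPP => hn.
have [bS mS] := mu_supp hmu bE he.
set E' := (fun x => E x /\ supp mu x) in bS mS.
set W := rsum (fun k : 'I_N => w k).
have W0 : 0 <= W by apply: rsum_ge0.
have hgt y : E' y -> p' * W < rsum (fun k : 'I_N => w k * ind (H k y)).
  by move=> [Ey Sy]; apply: Rnot_le_lt => h; apply: hn; exists y.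
have [y Ey] : exists y, E' y.
  apply: NNPP => h; move: mS; have -> : E' = (fun _ => False).
    by apply: set_ext => y; split => // hy; apply: h; exists y.
  by rewrite (proj1 hmu) => -[h0]; lra.
have := mu_sum_ge (w := w) (N := N) hmu bH bS mS (fun y h => Rlt_le _ _ (hgt y h)).
have : rsum (fun k : 'I_N => w k * mreal mu (fun y => E' y /\ H k y)) <= (p * e) * W.
  rewrite /W -rsumZ; apply: rsum_le => k.
  rewrite Rmult_comm; apply: Rmult_le_compat_r => //.
  apply: Rle_trans (hp k).
  have [c hc _] := mu_mono hmu (borelI bE (bH k)) bE (fun x h => proj1 h) he.
  have [c' hc' c0] := mu_mono hmu (borelI bS (bH k)) (borelI bE (bH k))
     (fun x h => conj (proj1 (proj1 h)) (proj2 h)) hc.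
  by rewrite /mreal hc hc'; lra.
move=> h1 h2; have W00 : W = 0.
  have pe : 0 < (p' - p) * e by apply: Rmult_lt_0_compat; lra.
  by have : (p' - p) * e * W <= 0; [lra | nra].
have := hgt y Ey; rewrite W00 Rmult_0_r.
suff : rsum (fun k : 'I_N => w k * ind (H k y)) <= W by lra.
by apply: rsum_le => k; have := w0 k; have := ind_bound (H k y); nra.
Qed.

(** * Avoiding hyperplanes *)

Lemma vnorm_gt0_coord n (a : vec n) : 0 < vnorm a -> exists i, a i <> 0.
Proof.
move=> a0; apply: NNPP => h; suff : vnorm a = 0 by lra.
rewrite -(vnorm0 n); congr vnorm; apply: functional_extensionality => i.
by apply: NNPP => ai; apply: h; exists i.
Qed.

(** The bound on [alpha] rearranges to [C^(1/gam) * 2 alpha / (1 - alpha) < 1]; it remains to raise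
    this to the power [gam]. *)
Lemma decay_factor_lt1 C gam alpha : 0 < C -> 0 < gam -> 0 < alpha ->
  alpha < 1 / (2 * Rpower C (1 / gam) + 1) ->
  alpha < 1 /\ 0 < C * Rpower (2 * alpha / (1 - alpha)) gam < 1.
Proof.
move=> C0 g0 a0 ha; set c1 := Rpower C (1 / gam) in ha.
have c0 : 0 < c1 by apply: exp_pos.
have h1 : alpha * (2 * c1 + 1) < 1.
  apply: (Rmult_lt_reg_r (/ (2 * c1 + 1))); first by apply: Rinv_0_lt_compat; lra.
  by rewrite Rmult_assoc Rinv_r; lra.
have a1 : alpha < 1 by nra.
split => //.
have u0 : 0 < 2 * alpha / (1 - alpha) by apply: Rdiv_lt_0_compat; lra.
split; first by apply: Rmult_lt_0_compat => //; apply: exp_pos.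
have cC : Rpower c1 gam = C.
  by rewrite Rpower_mult (_ : 1 / gam * gam = 1); [rewrite Rpower_1 | field; lra].
rewrite -{1}cC Rpower_mult_distr //.
apply: (@Rlt_le_trans _ (Rpower 1 gam)); last first.
  by rewrite /Rpower ln_1 Rmult_0_r exp_0; lra.
apply: Rlt_Rpower_l => //; split; first exact: Rmult_lt_0_compat.
apply: (Rmult_lt_reg_r (1 - alpha)); first by lra.
by rewrite (_ : c1 * _ * _ = 2 * alpha * c1); [lra | field; lra].
Qed.

(* Among finitely many weighted hyperplanes, Alice can always stay away from all
   but a proportion [p] of the total weight. *)
Definition avoids_hyperplanes n (K : set n) (alpha p rho0 : R) : Prop :=
  forall x r N (a : nat -> vec n) (b w : nat -> R),
  K x -> 0 < r < rho0 -> (forall k, 0 < vnorm (a k)) -> (forall k, 0 <= w k) ->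
  exists x', [/\ K x', dist x x' <= (1 - alpha) * r &
    rsum (fun k : 'I_N => w k * ind (nbhd (hyperplane (a k) (b k)) (2 * alpha * r) x'))
    <= p * rsum (fun k : 'I_N => w k)].

(** Alice's legal centres fill the ball of radius [(1 - alpha) r]. A strip of half-width [2 alpha r]
    takes less than the decay factor of its measure, and averaging does the rest. *)
Lemma decaying_avoids_hyperplanes n (mu : set n -> ereal) C gam alpha p :
  borel_measure mu -> abs_decaying mu C gam -> 0 < alpha < 1 ->
  C * Rpower (2 * alpha / (1 - alpha)) gam < p ->
  exists rho0, 0 < rho0 /\ avoids_hyperplanes (supp mu) alpha p rho0.
Proof.
move=> hmu [rho0 [rho00 dec]] a01 hp; exists rho0; split => //.
move=> x r N a b w sx r0 a0 w0.
set R1 := (1 - alpha) * r.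
have R0 : 0 < R1 by apply: Rmult_lt_0_compat; lra.
have R1r : R1 < rho0 by rewrite /R1; nra.
have bB : borel (cball x R1) by apply: borel_cball.
(* Decay applied to a strip through [x] wide enough to contain the ball: the strict inequality
   excludes both an infinite and a zero measure. *)
have [e he e0] : exists2 e, mu (cball x R1) = Fin e & 0 < e.
  have := dec (a 0%N) (dot (a 0%N) x) (vnorm_gt0_coord (a0 0%N)) x sx R1 R1 R0 R1r R0.
  have -> : (fun y => cball x R1 y /\ nbhd (hyperplane (a 0%N) (dot (a 0%N) x)) R1 y) = cball x R1.
    apply: set_ext => y; split; first by case.
    move=> xy; split => // u u0; exists x; split => //.
    by move: xy; rewrite /cball dist_sym; lra.
  case E : (mu _) => [e|] //= h; exists e => //.
  have := proj1 (proj2 hmu) _ bB e E.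
  by case=> // e0; move: h; rewrite -e0; lra.
have [||y [Ey sy hy]] := @supp_avoids_on_average _ mu _ e w
  (fun k => nbhd (hyperplane (a k) (b k)) (2 * alpha * r)) N
  (C * Rpower (2 * alpha / (1 - alpha)) gam) p hmu bB he e0 _ w0 hp.
- by move=> k; apply: borel_nbhd.
- move=> k.
  have e2 : 0 < 2 * alpha * r by apply: Rmult_lt_0_compat; lra.
  have := dec (a k) (b k) (vnorm_gt0_coord (a0 k)) x sx R1 (2 * alpha * r) R0 R1r e2.
  rewrite he /mreal; case: (mu _) => [v|] //=.
  by rewrite (_ : 2 * alpha * r / R1 = 2 * alpha / (1 - alpha)); [lra | rewrite /R1; field; lra].
by exists y; split.
Qed.

(** * Threshold crossing and counting indices in a window *)

Lemma exists_switch (P : nat -> Prop) : ~ P 0%N -> (exists j, P j) -> exists j, ~ P j /\ P j.+1.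
Proof.
move=> P0 [j]; elim: j => // j IH Pj; case: (classic (P j)) => // nP.
by exists j.
Qed.

(** The bound [L] alone is not inductive in [N]; the minimum records how much of the window lies
    below [N]. *)
Lemma rsum_ind_window (P : nat -> Prop) L k0 N : (forall k, P k -> (k0 <= k < k0 + L)%N) ->
  rsum (fun k : 'I_N => ind (P k)) <= INR (minn (N - k0) L).
Proof.
move=> hP; elim: N => [|N IH]; first by rewrite rsum_ord0; apply: pos_INR.
rewrite (rsum_recr (fun k => ind (P k))).
case: (classic (P N)) => PN.
  rewrite (ind1 PN); have /andP [h1 h2] := hP N PN.
  have -> : minn (N.+1 - k0) L = (minn (N - k0) L).+1.
    have lt : (N - k0 < L)%N by rewrite ltn_subLR.
    by rewrite subSn // (minn_idPl lt) (minn_idPl (ltnW lt)).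
  by rewrite S_INR; lra.
rewrite (ind0 PN) Rplus_0_r; apply: Rle_trans IH _; apply: le_INR; apply/leP.
by rewrite leq_min geq_minr (leq_trans (geq_minl _ _)) // leq_sub2r.
Qed.

Lemma rsum_ind_spread (P : nat -> Prop) L N :
  (forall k k', P k -> P k' -> (k <= k')%N -> (k' < k + L)%N) ->
  rsum (fun k : 'I_N => ind (P k)) <= INR L.
Proof.
move=> hP; case: (classic (exists k, P k)) => [ex|nex].
  have [k0 Pk0 k0min] : exists2 k0, P k0 & forall k, P k -> (k0 <= k)%N.
    case: ex => k; elim/ltn_ind: k => k IH Pk.
    case: (classic (exists2 j, (j < k)%N & P j)) => [[j jk Pj]|h]; first exact: (IH j).
    by exists k => // j Pj; rewrite leqNgt; apply/negP => jk; apply: h; exists j.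
  apply: (Rle_trans _ _ _ (@rsum_ind_window P L k0 N _)).
    by move=> k Pk; rewrite k0min //=; apply: hP => //; apply: k0min.
  by apply: le_INR; apply/leP; apply: geq_minr.
apply: (Rle_trans _ 0); last exact: pos_INR.
rewrite (eq_rsum (g := fun _ => 0)); first by rewrite rsum_const; lra.
by move=> k; apply: ind0 => Pk; apply: nex; exists k.
Qed.

(** * The potential *)

Lemma exp_le_compat x y : x <= y -> exp x <= exp y.
Proof. by case=> [/exp_increasing /Rlt_le | ->] //; apply: Rle_refl. Qed.

Section Potential.

Variables (m n : nat) (M : nat -> mat m n) (Z : nat -> vec m -> Prop) (K : set n).
Variables (t : nat -> R) (row : nat -> 'I_m) (q delta eta alpha s p rho0 theta : R).
Hypotheses (t_opnorm : forall k, is_opnorm (M k) (t k)) (t_gt0 : forall k, 0 < t k).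
Hypotheses (q_gt1 : 1 < q) (t_lacunary : forall k, q * t k <= t k.+1).
Hypotheses (eta01 : 0 < eta <= 1) (row_large : forall k, eta * t k <= vnorm (M k (row k))).
Hypotheses (delta_gt0 : 0 < delta)
  (Z_discrete : forall k x y, Z k x -> Z k y -> x <> y -> delta < dist x y).
Hypotheses (alpha01 : 0 < alpha < 1) (s_gt0 : 0 < s) (s_alpha : s < alpha).
Hypotheses (theta_gt0 : 0 < theta) (p_gt0 : 0 < p) (K_avoids : avoids_hyperplanes K alpha p rho0).

Let c := delta / 4.
(** This is [s^(- theta)], the factor by which a weight grows in one round. *)
Let lam := exp (- theta * ln s).

Let c_gt0 : 0 < c. Proof. by rewrite /c; lra. Qed.
Let lam_gt0 : 0 < lam. Proof. exact: exp_pos. Qed.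

(** As the chosen row has length at least [eta * t k], the threshold puts [y] within [alpha * r] of
    the hyperplane where that row takes the value of the matching coordinate of [z]. *)
Definition near k r (y : vec n) z := Z k z /\ dist (mat_app (M k) y) z <= alpha * eta * t k * r.

(* [k] has become relevant at scale [r] and its obstacles still meet the ball. *)
Definition alive k x r := t k * r <= c /\ exists z y, cball x r y /\ near k r y z.

Definition weight k r := exp (- theta * ln (t k * r)).

Definition potential N x r := rsum (fun k : 'I_N => ind (alive k x r) * weight k r).

Lemma t_grow k j : q ^ j * t k <= t (k + j).
Proof.
elim: j => [|j IH]; first by rewrite addn0 /=; lra.
rewrite addnS /=; apply: Rle_trans (t_lacunary _).
by rewrite Rmult_assoc; apply: Rmult_le_compat_l; lra.
Qed.

Lemma t_mono k : t 0 <= t k.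
Proof.
have := t_grow 0 k; rewrite add0n; apply: Rle_trans.
rewrite -{1}(Rmult_1_l (t 0)); apply: Rmult_le_compat_r; first exact: Rlt_le.
by apply: pow_R1_Rle; lra.
Qed.

Lemma q_pow_large A : exists N, forall k, (N <= k)%N -> A < q ^ k.
Proof.
have q1 : Rabs q > 1 by rewrite Rabs_pos_eq; lra.
have [N hN] := Pow_x_infinity q q1 (A + 1); exists N => k /leP Nk.
have := hN k Nk; rewrite Rabs_pos_eq; first by lra.
by apply: pow_le; lra.
Qed.

Lemma t_large A : exists N, forall k, (N <= k)%N -> A < t k.
Proof.
have [N hN] := q_pow_large (A / t 0); exists N => k Nk.
have := t_grow 0 k; rewrite add0n; apply: Rlt_le_trans.
have := Rmult_lt_compat_r _ _ _ (t_gt0 0) (hN k Nk).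
by rewrite (_ : A / t 0 * t 0 = A) //; field; have := t_gt0 0; lra.
Qed.

Lemma weight_gt0 k r : 0 < weight k r.
Proof. exact: exp_pos. Qed.

Lemma weight_scale k r : 0 < r -> weight k (s * r) = lam * weight k r.
Proof.
move=> r0; rewrite /weight /lam -exp_plus; congr exp.
rewrite (_ : t k * (s * r) = s * (t k * r)); last by ring.
by rewrite ln_mult //; [ring | apply: Rmult_lt_0_compat].
Qed.

Lemma potential_term_ge0 k x r : 0 <= ind (alive k x r) * weight k r.
Proof.
by apply: Rmult_le_pos; [case: (ind_bound (alive k x r)) | apply: Rlt_le; apply: weight_gt0].
Qed.

(** Only finitely many [k] satisfy [t k * r <= c], because [t] grows geometrically. *)
Lemma potential_bounded x r : 0 < r ->
  exists N0, forall N, potential N x r <= potential N0 x r.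
Proof.
move=> r0; have [N0 hN0] := t_large (c / r); exists N0 => N.
apply: (rsum_trunc (f := fun k => ind (alive k x r) * weight k r)) => k.
  exact: potential_term_ge0.
move=> /hN0 hk; rewrite ind0; first by ring.
case=> hc _; have := Rmult_lt_compat_r _ _ _ r0 hk.
by rewrite (_ : c / r * r = c); [lra | field; lra].
Qed.

Lemma near_unique k x r y y' z z' : 0 < r -> t k * r <= c ->
  cball x r y -> cball x r y' -> near k r y z -> near k r y' z' -> z = z'.
Proof.
move=> r0 hc xy xy' [Zz dz] [Zz' dz']; apply: NNPP => /(Z_discrete Zz Zz') zz'.
have h1 := dist_tri (mat_app (M k) y) z z'.
have h2 := dist_tri (mat_app (M k) y') (mat_app (M k) y) z'.
have h3 := dist_mat_app y y' (t_opnorm k).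
have h4 := dist_tri x y y'.
rewrite (dist_sym z (mat_app _ _)) in h1; rewrite (dist_sym y x) in h4.
have h5 : t k * dist y y' <= t k * (2 * r).
  by apply: Rmult_le_compat_l; [apply: Rlt_le | move: xy xy'; rewrite /cball; lra].
have h6 : alpha * eta * t k * r <= c.
  rewrite Rmult_assoc; apply: Rle_trans hc.
  rewrite -{2}(Rmult_1_l (t k * r)); apply: Rmult_le_compat_r; last by nra.
  by apply: Rmult_le_pos; apply: Rlt_le.
by move: hc h6 h5; rewrite /c; lra.
Qed.

(** Covers every centre Bob may legally choose after Alice plays [x']. Bounds uniform in [N] stand
    for the full infinite sum. *)
Definition step_bound D (w : move n) (x' : vec n) : Prop :=
  forall x'', dist x' x'' <= alpha * w.2 - s * w.2 ->
  forall W, (forall N, potential N w.1 w.2 <= W) ->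
  forall N, potential N x'' (s * w.2) <= lam * p * W + D.

(** An index alive after the round either was alive before and has [x'] in its strip, which costs at
    most [lam * p * W] in all, or is newly relevant, which costs a constant. *)
Lemma potential_step : exists D, forall w : move n, K w.1 -> 0 < w.2 < rho0 ->
  exists x', [/\ K x', dist w.1 x' <= (1 - alpha) * w.2 & step_bound D w x'].
Proof.
have [L hL] := q_pow_large (/ s).
pose Dw := exp (- theta * ln (c * s)).
exists (INR L * Dw) => -[x r] /= Kx [r0 rr].
have sr0 : 0 < s * r by apply: Rmult_lt_0_compat.
have [N0 hN0] := t_large (c / (s * r)).
(* The only point of [Z k] that matters when [k] is alive; otherwise it may be arbitrary, as the
   weight [v k] is then zero. *)
pose zc k := epsilon (inhabits (fun _ : 'I_m => 0))
  (fun z => exists y, cball x r y /\ near k r y z).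
pose v k := ind (alive k x r) * weight k r.
have a0 k : 0 < vnorm (M k (row k)).
  by apply: Rlt_le_trans (row_large k); apply: Rmult_lt_0_compat => //; lra.
have [x' [Kx' xx' hx']] := @K_avoids x r N0 (fun k => M k (row k))
  (fun k => zc k (row k)) v Kx (conj r0 rr) a0 (fun k => potential_term_ge0 k x r).
exists x'; split => // x'' /= xx'' W hW N.
have sub y : cball x'' (s * r) y -> dist x' y <= alpha * r.
  by move=> h; have := dist_tri x'' x' y; move: h; rewrite /cball; lra.
have sub' y : cball x'' (s * r) y -> cball x r y.
  by move=> /sub h; rewrite /cball; have := dist_tri x' x y; lra.
set H := (fun k => nbhd (hyperplane (M k (row k)) (zc k (row k))) (2 * alpha * r)) in hx'.
pose fresh k := c < t k * r /\ t k * r <= c / s.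
have srr : s * r <= r by nra.
have old k : t k * r <= c -> alive k x'' (s * r) -> alive k x r /\ H k x'.
  move=> tc [_ [z [y [hy [Zz dz]]]]].
  have nz : near k r y z.
    split => //; apply: Rle_trans dz _; apply: Rmult_le_compat_l => //.
    by apply: Rmult_le_pos; [apply: Rmult_le_pos; lra | apply: Rlt_le].
  have al : alive k x r by split => //; exists z, y; split => //; apply: sub'.
  split => //; apply: NNPP => /(not_nbhd_hyperplane (a0 k)) far.
  have [y' [hy' nzc]] : exists y', cball x r y' /\ near k r y' (zc k).
    apply: (epsilon_spec _ (fun z => exists y, cball x r y /\ near k r y z)).
    by exists z, y; split => //; apply: sub'.
  have zE := near_unique r0 tc (sub' y hy) hy' nz nzc.
  rewrite -zE in far.
  (* Passing from [x'] to [y] and from the image of [y] to [z] each changes the row coordinate by at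
     most [alpha * r] times the row length, contradicting [far]. *)
  have e1 := dot_le (M k (row k)) (fun i => x' i - y i).
  rewrite dotB -distE in e1.
  have e2 := coord_le_vnorm (fun i => mat_app (M k) y i - z i) (row k).
  rewrite -distE /mat_app -/(dot _ _) in e2.
  have e3 := Rabs_triang (dot (M k (row k)) x' - dot (M k (row k)) y)
    (dot (M k (row k)) y - z (row k)).
  rewrite (_ : _ - _ + _ = dot (M k (row k)) x' - z (row k)) in e3; last by ring.
  have e4 : vnorm (M k (row k)) * dist x' y <= vnorm (M k (row k)) * (alpha * r).
    by apply: Rmult_le_compat_l; [apply: Rlt_le | apply: sub].
  have e5 : alpha * eta * t k * (s * r) <= vnorm (M k (row k)) * (alpha * r).
    rewrite (_ : alpha * eta * t k * (s * r) = (s * (eta * t k)) * (alpha * r)); last by ring.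
    apply: Rmult_le_compat_r; first by apply: Rmult_le_pos; lra.
    have := row_large k; have : 0 < eta * t k by apply: Rmult_lt_0_compat => //; lra.
    by nra.
  have e6 : Rabs (dot (M k (row k)) y - z (row k)) <= alpha * eta * t k * (s * r).
    exact: Rle_trans e2 dz.
  by lra.
have pw k : ind (alive k x'' (s * r)) * weight k (s * r) <=
    lam * (v k * ind (H k x')) + Dw * ind (fresh k).
  have v0 : 0 <= v k := potential_term_ge0 k x r.
  have Dw0 : 0 < Dw by apply: exp_pos.
  have p1 : 0 <= lam * (v k * ind (H k x')).
    by apply: Rmult_le_pos; [lra | apply: Rmult_le_pos => //; case: (ind_bound (H k x'))].
  have p2 : 0 <= Dw * ind (fresh k).
    by apply: Rmult_le_pos; [lra | case: (ind_bound (fresh k))].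
  case: (classic (alive k x'' (s * r))) => al; last by rewrite (ind0 al) Rmult_0_l; lra.
  rewrite (ind1 al) Rmult_1_l.
  case: (Rle_lt_dec (t k * r) c) => tc.
    have [al' Hk] := old k tc al.
    by rewrite /v (ind1 al') (ind1 Hk) weight_scale // in p1 *; lra.
  have fr : fresh k.
    split => //; case: al => al _.
    apply: (Rmult_le_reg_l s) => //; rewrite (_ : s * (c / s) = c); last by field; lra.
    by lra.
  rewrite (ind1 fr) Rmult_1_r; suff : weight k (s * r) <= Dw by lra.
  rewrite /weight /Dw; apply: exp_le_compat.
  suff : ln (c * s) < ln (t k * (s * r)) by nra.
  by apply: ln_increasing; nra.
apply: (@Rle_trans _ (potential N0 x'' (s * r))).
  apply: (rsum_trunc (f := fun k => ind (alive k x'' (s * r)) * weight k (s * r))) => k.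
    exact: potential_term_ge0.
  move=> /hN0 hk; rewrite ind0; first by ring.
  case=> hc _; have := Rmult_lt_compat_r _ _ _ sr0 hk.
  by rewrite (_ : c / (s * r) * (s * r) = c); [lra | field; lra].
apply: (Rle_trans _ _ _ (rsum_le pw)).
rewrite rsumD !rsumZ; apply: Rplus_le_compat.
  rewrite Rmult_assoc; apply: Rmult_le_compat_l; first by lra.
  by apply: Rle_trans hx' _; apply: Rmult_le_compat_l; [lra | apply: hW].
rewrite Rmult_comm; apply: Rmult_le_compat_r; first by apply: Rlt_le; apply: exp_pos.
(* Fresh indices have [t k * r] between [c] and [c / s]; [L] lacunary steps multiply it by more than
   [/ s], so they lie in a window of length [L]. *)
apply: (rsum_ind_spread (P := fresh)) => k k' [k1 _] [_ k2] kk'.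
rewrite ltnNge; apply/negP => far.
have := hL (k' - k)%N; rewrite leq_subRL // => /(_ far) big.
have := t_grow k (k' - k); rewrite subnKC // => tk.
have h1 : / s * t k < t k' by apply: Rlt_le_trans tk; apply: Rmult_lt_compat_r.
have h2 : / s * t k * r < t k' * r by apply: Rmult_lt_compat_r.
have h3 : / s * c < / s * (t k * r).
  by apply: Rmult_lt_compat_l => //; apply: Rinv_0_lt_compat.
by move: k2; rewrite /Rdiv; lra.
Qed.

Hypotheses (contracting : lam * p < 1) (rho0_gt0 : 0 < rho0).

(** While the radius is at least [rho0], Alice keeps Bob's centre and waits. *)
Lemma potential_strategy : exists (D : R) (f : move n -> vec n),
  forall w : move n, K w.1 -> 0 < w.2 ->
  [/\ K (f w), dist w.1 (f w) <= (1 - alpha) * w.2 &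
      w.2 < rho0 -> step_bound D w (f w)].
Proof.
have [D hD] := potential_step; exists D.
pose good (w : move n) (x' : vec n) := [/\ K x', dist w.1 x' <= (1 - alpha) * w.2 &
      w.2 < rho0 -> step_bound D w x'].
exists (fun w => epsilon (inhabits w.1) (good w)) => w Kw w0.
apply: (epsilon_spec _ (good w)).
case: (Rlt_le_dec w.2 rho0) => hw.
  by have [x' [h1 h2 h3]] := hD w Kw (conj w0 hw); exists x'.
exists w.1; split => //; last by lra.
by rewrite distxx; apply: Rmult_le_pos; lra.
Qed.

(** Since [lam * p < 1], the recursion keeps the potential bounded, whereas an index alive at a tiny
    value of [t k * r] would have a weight above any bound. *)
Lemma potential_wins D (x : nat -> vec n) r0 (y : vec n) : 0 < r0 ->
  (forall k, cball (x k) (s ^ k * r0) y) ->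
  (forall k, s ^ k * r0 < rho0 -> forall W,
     (forall N, potential N (x k) (s ^ k * r0) <= W) ->
     forall N, potential N (x k.+1) (s ^ k.+1 * r0) <= lam * p * W + D) ->
  Etilde M Z y.
Proof.
move=> r00 hy hstep.
pose r k := s ^ k * r0.
have r_gt0 k : 0 < r k by apply: Rmult_lt_0_compat => //; apply: pow_lt.
have s1 : Rabs s < 1 by rewrite Rabs_pos_eq; lra.
have small A : 0 < A -> exists N, forall k, (N <= k)%N -> r k < A.
  move=> A0; have [|N hN] := pow_lt_1_zero s s1 (A / r0); first exact: Rdiv_lt_0_compat.
  exists N => k /leP Nk; have := hN k Nk; rewrite Rabs_pos_eq; last by apply: pow_le; lra.
  move=> h; have := Rmult_lt_compat_r _ _ _ r00 h.
  by rewrite (_ : A / r0 * r0 = A) //; field; lra.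
have [i0 hi0] := small rho0 rho0_gt0.
have [N0 hN0] := potential_bounded (x i0) (r_gt0 i0).
(* The last entry is the fixed point of the recursion, so every larger value is preserved; the entry
   1 makes [ln W] meaningful. *)
pose W := Rmax 1 (Rmax (potential N0 (x i0) (r i0)) (D / (1 - lam * p))).
have W1 : 1 <= W by apply: Rmax_l.
have WD : lam * p * W + D <= W.
  have : D / (1 - lam * p) <= W by apply: Rle_trans (Rmax_r _ _); apply: Rmax_r.
  move=> h; have := Rmult_le_compat_l (1 - lam * p) _ _ _ h.
  by rewrite (_ : _ * (D / _) = D); [lra | field; lra].
have bounded j N : potential N (x (i0 + j)%N) (r (i0 + j)%N) <= W.
  elim: j N => [|j IH] N.
    rewrite addn0; apply: Rle_trans (hN0 N) _.
    by apply: Rle_trans (Rmax_r _ _); apply: Rmax_l.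
  rewrite addnS; apply: Rle_trans WD; apply: hstep => //.
  by apply: hi0; apply: leq_addr.
(* below this scale a single surviving index would already exceed the bound *)
pose kap := Rmin (exp (- ln W / theta)) (Rmin c (t 0 * r i0)).
have kap0 : 0 < kap.
  by apply: Rmin_pos; [apply: exp_pos | apply: Rmin_pos => //; apply: Rmult_lt_0_compat].
have kap1 : kap <= exp (- ln W / theta) by apply: Rmin_l.
have kap2 : kap <= c by apply: Rle_trans (Rmin_r _ _) _; apply: Rmin_l.
have kap3 : kap <= t 0 * r i0 by apply: Rle_trans (Rmin_r _ _) _; apply: Rmin_r.
have ae0 : 0 < alpha * eta by apply: Rmult_lt_0_compat; lra.
exists (alpha * eta * (s * kap)); split.
  by apply: Rmult_lt_0_compat => //; apply: Rmult_lt_0_compat.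
move=> k z Zz.
(* At the first radius [t k * r i0 >= kap], by the entry [t 0 * r i0] of [kap]. Just after the
   crossing, [t k * r] is still at least [s * kap], whence a bound uniform in [k]. *)
have [||j [hj1 hj2]] := @exists_switch (fun j => t k * r (i0 + j)%N < kap).
- rewrite addn0; have := Rmult_le_compat_r _ _ _ (Rlt_le _ _ (r_gt0 i0)) (t_mono k); lra.
- have [|N hN] := small (kap / t k); first exact: Rdiv_lt_0_compat.
  exists N; have := Rmult_lt_compat_l _ _ _ (t_gt0 k) (hN (i0 + N)%N (leq_addl _ _)).
  by rewrite (_ : t k * (kap / t k) = kap) //; field; have := t_gt0 k; lra.
have dead : ~ alive k (x (i0 + j.+1)%N) (r (i0 + j.+1)%N).
  move=> al; have := bounded j.+1 k.+1; set rr := r _ in al hj2 *.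
  have := rsum_ge_term (f := fun i : 'I_k.+1 => ind (alive i (x (i0 + j.+1)%N) rr) * weight i rr)
    (@ord_max k) (fun i => potential_term_ge0 i _ _).
  rewrite /= (ind1 al) Rmult_1_l -/(potential _ _ _).
  suff : W < weight k rr by lra.
  have u0 : 0 < t k * rr := Rmult_lt_0_compat _ _ (t_gt0 k) (r_gt0 _).
  rewrite -(exp_ln W); last by lra.
  apply: exp_increasing.
  have : ln (t k * rr) < - ln W / theta.
    by rewrite -(ln_exp (- ln W / theta)); apply: ln_increasing => //; lra.
  move=> h; have := Rmult_lt_compat_l _ _ _ theta_gt0 h.
  by rewrite (_ : theta * (- ln W / theta) = - ln W); [lra | field; lra].
have far : alpha * eta * t k * r (i0 + j.+1)%N < dist (mat_app (M k) y) z.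
  apply: Rnot_le_lt => h; apply: dead; split; first by lra.
  by exists z, y; split; [apply: hy | split].
apply: Rlt_le; apply: Rle_lt_trans far; rewrite [X in _ <= X]Rmult_assoc.
apply: Rmult_le_compat_l; first by lra.
rewrite addnS (_ : t k * r _ = s * (t k * r (i0 + j)%N)); last by rewrite /r /=; ring.
by apply: Rmult_le_compat_l; lra.
Qed.

End Potential.

(** * Choice of parameters and the winning strategy *)

Theorem theorem4p1 (m n : nat) (mu : set n -> ereal) (C gam : R) :
  borel_measure mu -> locally_finite mu ->
  0 < C -> 0 < gam -> abs_decaying mu C gam ->
  forall alpha : R, 0 < alpha -> alpha < 1 / (2 * Rpower C (1 / gam) + 1) ->
  forall (Z : nat -> vec m -> Prop) (M : nat -> mat m n),
    unif_discrete Z -> lacunary M ->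
    alpha_winning (supp mu) alpha (Etilde M Z).
Proof.
move=> hmu _ C0 g0 dec alpha a0 ha Z M [delta [delta0 hZ]] [nz [q [q1 lac]]] beta b01.
have [a1 [p0 p1]] := decay_factor_lt1 C0 g0 a0 ha; set p1' := C * _ in p0 p1.
(* Averaging needs [p] strictly above the decay factor, contraction needs it below 1. *)
pose p := (1 + p1') / 2.
have [|rho0 [rho00 av]] := decaying_avoids_hyperplanes (p := p) hmu dec (conj a0 a1).
  by rewrite -/p1' /p; lra.
pose t k := proj1_sig (constructive_indefinite_description _ (opnorm_exists (M k))).
have ht k : is_opnorm (M k) (t k).
  exact: (proj2_sig (constructive_indefinite_description _ (opnorm_exists (M k)))).
have t0 k : 0 < t k := opnorm_gt0 (nz k) (ht k).
have tl k : q * t k <= t k.+1.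
  have := Rmult_le_compat_r _ _ _ (Rlt_le _ _ (t0 k)) (lac k _ _ (ht k) (ht k.+1)).
  by rewrite (_ : t k.+1 / t k * t k = t k.+1) //; field; have := t0 k; lra.
have m1 : 1 <= INR m.
  case: (nz 0%N) => i _; apply: (le_INR 1); apply/leP; exact: leq_ltn_trans (ltn_ord i).
have sm : 1 <= sqrt (INR m) by rewrite -sqrt_1; apply: sqrt_le_1_alt.
pose eta := / (2 * sqrt (INR m)).
have eta01 : 0 < eta <= 1.
  split; first by apply: Rinv_0_lt_compat; lra.
  by rewrite -Rinv_1; apply: Rinv_le_contravar; lra.
pose row k := proj1_sig (constructive_indefinite_description _ (opnorm_row (nz k) (ht k))).
have hrow k : eta * t k <= vnorm (M k (row k)).
  have := proj2_sig (constructive_indefinite_description _ (opnorm_row (nz k) (ht k))).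
  by rewrite -/(row k) /eta /Rdiv Rmult_comm.
pose s := alpha * beta.
have s0 : 0 < s by apply: Rmult_lt_0_compat; lra.
have sa : s < alpha by rewrite /s; nra.
have p01 : 0 < p < 1 by rewrite /p; lra.
have lns : ln s < 0 by rewrite -ln_1; apply: ln_increasing; lra.
have lnp : ln p < 0 by rewrite -ln_1; apply: ln_increasing; lra.
(* chosen so that [s ^ (- theta) * p = sqrt p] *)
pose theta := ln p / (2 * ln s).
have th0 : 0 < theta.
  rewrite /theta (_ : ln p / (2 * ln s) = - ln p / (2 * - ln s)); last by field; lra.
  by apply: Rdiv_lt_0_compat; lra.
have ctr : exp (- theta * ln s) * p < 1.
  rewrite -{1}(exp_ln p); last by lra.
  rewrite -exp_plus (_ : _ + _ = ln p / 2); last by rewrite /theta; field; lra.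
  by rewrite -exp_0; apply: exp_increasing; lra.
have [D [f hf]] := potential_strategy ht t0 q1 tl eta01 hrow delta0 hZ (conj a0 a1)
  s0 sa th0 (proj1 p01) av.
(* Only Bob's last move matters; the default is never reached, as the histories in play are
   nonempty. *)
pose sigma : strategy n := fun h => let w := last ((fun _ => 0), 0) h in (f w, alpha * w.2).
have sigE (b : nat -> move n) k : sigma (mkseq b k.+1) = (f (b k), alpha * (b k).2).
  by rewrite /sigma mkseqS last_rcons.
exists sigma => b a Kb0 rb0.
have aE k : a k = (f (b k), alpha * (b k).2) := sigE b k.
have legal k : (forall j, (j < k)%N ->
     supp mu (b j.+1).1 /\ (b j.+1).2 = beta * (a j).2 /\ le_s (b j.+1) (a j)) ->
   supp mu (b k).1 /\ (b k).2 = s ^ k * (b 0%N).2.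
  move=> hb; have rad j : (j <= k)%N -> (b j).2 = s ^ j * (b 0%N).2.
    elim: j => [|j IH] jk; first by rewrite /=; ring.
    have [_ [-> _]] := hb j jk; rewrite aE /= IH ?(ltnW jk) // /s; ring.
  split; last exact: rad.
  by case: k hb {rad} => // k hb; case: (hb k (ltnSn k)).
have rpos k : 0 < s ^ k * (b 0%N).2 by apply: Rmult_lt_0_compat => //; apply: pow_lt.
split=> [k /legal [Kk rk]|hb x hx].
  have bk0 : 0 < (b k).2 by rewrite rk.
  have [h1 h2 _] := hf (b k) Kk bk0.
  by rewrite aE /le_s /=; split=> //; split=> //; lra.
split; last by case: (hx 0%N).
have allK k := legal k (fun j _ => hb j).
apply: (potential_wins t0 q1 tl eta01 delta0 (conj a0 a1) s0 sa th0 ctr rho00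
          (D := D) (x := fun k => (b k).1) (r0 := (b 0%N).2)) => // k.
  by have [_ <-] := allK k; case: (hx k).
have [Kk rk] := allK k; have [_ rk1] := allK k.+1; rewrite -rk -rk1 => small W hW N.
have bk0 : 0 < (b k).2 by rewrite rk.
have [_ _ /(_ small) st] := hf (b k) Kk bk0.
have rk1s : (b k.+1).2 = s * (b k).2 by rewrite rk1 rk /=; ring.
rewrite rk1s; apply: st => //.
(* Legality of Bob's move is exactly the displacement bound required by [step_bound]. *)
have [_ [_ ]] := hb k; rewrite aE /le_s /= rk1s; lra.
Qed.
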